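(* Let $G$ be a finite simple undirected graph with vertex set $[n]=\{1,\ldots,n\}$, and let $\chi_G$ be its chromatic polynomial. For any non-negative integers $i,j$, the number $(-1)^{n-i}\chi_G^{(i)}(-j)$ (where $\chi_G^{(i)}$ is the $i$-th derivative of $\chi_G$) equals the number of tuples $((V_1,\gamma_1),\ldots,(V_{i+j},\gamma_{i+j}))$ such that (1) $V_1,\ldots,V_{i+j}$ are pairwise disjoint subsets of $[n]$ with $\bigcup_k V_k=[n]$; (2) for every $k\in[i+j]$, $\gamma_k$ is an acyclic orientation of the induced subgraph $G[V_k]$; (3) for every $k\in[i]$, $V_k\neq\emptyset$ and $\gamma_k$ has a unique source, which is the vertex $\min(V_k)$.
   Context: $[0]=\emptyset$. The chromatic polynomial $\chi_G$ is the polynomial such that for each positive integer $q$, $\chi_G(q)$ is the number of proper colorings of $G$ with colors in $[q]$. $G[U]$ denotes the subgraph induced by $U$ (vertex set $U$, edges of $G$ with both endpoints in $U$). An orientation is acyclic if it has no directed cycle; a source is a vertex with no ingoing edge. *)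

(* Defs.v *)
From mathcomp Require Import all_boot all_order all_algebra.

Set Implicit Arguments.
Unset Strict Implicit.
Unset Printing Implicit Defensive.

Import GRing.Theory Num.Theory.
Local Open Scope ring_scope.

Section Chromatic.

Variables (T : finType).

Definition proper_coloring (e : rel T) (q : nat) (f : {ffun T -> 'I_q}) : bool :=
  [forall u, forall v, e u v ==> (f u != f v)].

Definition is_chromatic_poly (e : rel T) (p : {poly int}) : Prop :=
  forall q : nat, (0 < q)%N ->
    p.[q%:R] = #|[set f : {ffun T -> 'I_q} | proper_coloring e f]|%:R.

Lemma card_comp_idem (r : T -> T) (q : nat) : (forall x, r (r x) = r x) ->
  #|[set f : {ffun T -> 'I_q} | [forall x, f (r x) == f x]]|
    = (q ^ #|[pred x | r x == x]|)%N.
Proof.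
move=> rr; have rP x : r (r x) == r x by rewrite rr.
pose P := [pred x | r x == x]; pose S := {x | P x}.
pose s x : S := exist (fun y => is_true (P y)) (r x) (rP x).
pose h (g : {ffun S -> 'I_q}) : {ffun T -> 'I_q} := [ffun x => g (s x)].
have hinj : injective h.
  move=> g1 g2 /ffunP E; apply/ffunP => -[x rx]; have := E x; rewrite !ffunE.
  suff -> : s x = Sub x rx by [].
  by apply: val_inj; rewrite /= (eqP rx).
have -> : [set f : {ffun T -> 'I_q} | [forall x, f (r x) == f x]]
          = [set h g | g in [set: {ffun S -> 'I_q}]].
  apply/setP => f; rewrite inE; apply/forallP/imsetP => [fr|[g _ ->] x].
    exists [ffun s : S => f (val s)] => //.
    by apply/ffunP => x; rewrite !ffunE /= (eqP (fr x)).
  rewrite !ffunE; apply/eqP; congr (g _); apply: val_inj; exact: rr.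
by rewrite card_imset // cardsT card_ffun card_ord card_sig.
Qed.

(* Deletion-contraction: [r] records the contracted vertices, [L] the remaining
   edges. *)
Lemma deletion_contraction (L : seq (T * T)) (r : T -> T) :
  (forall x, r (r x) = r x) ->
  {p : {poly int} | forall q : nat, p.[q%:R] =
    #|[set f : {ffun T -> 'I_q} | [forall x, f (r x) == f x]
         && all (fun uv => f uv.1 != f uv.2) L]|%:R}.
Proof.
elim: L r => [|[u v] L IHL] r rr.
  exists 'X^#|[pred x | r x == x]| => q.
  rewrite hornerXn -natrX -(card_comp_idem q rr).
  by congr (_%:R); apply: eq_card => f; rewrite !inE andbT.
pose r' x := if r x == r u then r v else r x.
have rr' x : r' (r' x) = r' x.
  rewrite /r'; case: (eqVneq (r x) (r u)) => [_|ne]; rewrite rr.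
    by rewrite if_same.
  by rewrite (negPf ne).
have [p1 H1] := IHL r rr; have [p2 H2] := IHL r' rr'.
exists (p1 - p2) => q; rewrite hornerD hornerN H1 H2; apply/eqP.
rewrite subr_eq -natrD eqr_nat; apply/eqP.
rewrite -(cardsID [set f : {ffun T -> 'I_q} | f u != f v]); congr (_ + _)%N.
  by apply: eq_card => f; rewrite !inE /= andbCA andbC andbA andbC.
apply: eq_card => f; rewrite !inE negbK andbA; congr (_ && _).
apply/andP/forallP => [[/eqP fuv /forallP fr] x|fr'].
  rewrite /r'; case: (r x =P r u) => [E|_]; last exact: fr.
  by rewrite (eqP (fr v)) -fuv -(eqP (fr u)) -E; apply: fr.
have E x : f (r' x) = f x by apply/eqP.
have fu : f u = f (r v) by rewrite -E /r' eqxx.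
have fv : f v = f (r v) by rewrite -E /r'; case: ifP.
split; first by rewrite fu fv.
apply/forallP => x; rewrite -[f (r x)]E -[f x]E /r' rr.
by case: (r x == r u); rewrite ?rr.
Qed.

Lemma chromatic_poly_subproof (e : rel T) :
  {p : {poly int} | is_chromatic_poly e p}.
Proof.
have [p Hp] := deletion_contraction
  [seq uv <- enum {: T * T} | e uv.1 uv.2] (fun x : T => erefl (id x)).
exists p => q _; rewrite Hp; congr (_%:R); apply: eq_card => f; rewrite !inE.
apply/andP/forallP => [[_ /allP H] u|H].
  apply/forallP => v; apply/implyP => euv.
  by apply: (H (u, v)); rewrite mem_filter euv mem_enum.
split; first exact/forallP.
apply/allP => -[u v]; rewrite mem_filter /= => /andP[euv _].
by have /forallP/(_ v)/implyP := H u; apply.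
Qed.

Definition chromatic_poly (e : rel T) : {poly int} :=
  sval (chromatic_poly_subproof e).

Lemma chromatic_polyP (e : rel T) : is_chromatic_poly e (chromatic_poly e).
Proof. exact: svalP. Qed.

Lemma chromatic_poly_unique (e : rel T) (p : {poly int}) :
  is_chromatic_poly e p -> p = chromatic_poly e.
Proof.
move=> Hp; apply/eqP; rewrite -subr_eq0; apply/contraT => nz.
pose s : seq int := [seq k.+1%:R | k <- iota 0 (size (p - chromatic_poly e))].
have := max_poly_roots (rs := s) nz; rewrite size_map size_iota ltnn; apply.
  apply/allP => _ /mapP[k _ ->].
  by rewrite /root hornerD hornerN Hp // chromatic_polyP // subrr.
rewrite map_inj_uniq ?iota_uniq // => a b /eqP.
by rewrite eqr_nat => /eqP[].
Qed.

End Chromatic.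

Section Orientations.

Variables (T : finType).

Implicit Types (e : rel T) (U : {set T}) (o : {set T * T}).

(* Edges of the induced subgraph G[U]; its vertex set is [U]. *)
Definition induced_edge e U : rel T :=
  [rel u v | [&& u \in U, v \in U & e u v]].

(* An orientation is represented by its set of arcs: [(u, v)] is the edge uv
   directed from u to v. *)
Definition arc o : rel T := [rel u v | (u, v) \in o].

Definition is_orientation e o : bool :=
  [forall u, forall v, ((arc o u v || arc o v u) == e u v)
                       && ~~ (arc o u v && arc o v u)].

(* A directed cycle has pairwise distinct vertices, hence length at most #|T|. *)
Definition acyclic o : bool :=
  [forall k : 'I_#|T|, forall c : k.+1.-tuple T, ~~ ucycleb (arc o) c].

Lemma acyclicP o :
  reflect (forall c : seq T, ucycle (arc o) c -> c = [::]) (acyclic o).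
Proof.
apply: (iffP forallP) => [H [|x c] // cyc|H k].
  have lt_c : (size c < #|T|)%N.
    by have /andP[_ /card_uniqP /= <-] := cyc; apply: max_card.
  have /forallP/(_ (in_tuple (x :: c))) := H (Ordinal lt_c).
  by move=> /negP[].
by apply/forallP => c; apply/negP => /H c0; have := size_tuple c; rewrite c0.
Qed.

Definition acyclic_orientation e o : bool := is_orientation e o && acyclic o.

Definition sources U o : {set T} := [set v in U | [forall u, ~~ arc o u v]].

End Orientations.

Section Tuples.

(* The vertex set [n] = {1, ..., n} is encoded as 'I_n with its usual order. *)
Variables (n : nat) (e : rel 'I_n).

Definition is_min (U : {set 'I_n}) (m : 'I_n) : bool :=
  (m \in U) && [forall u in U, (m <= u)%N].

Definition min_unique_source (U : {set 'I_n}) (o : {set 'I_n * 'I_n}) : bool :=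
  (U != set0) && [exists m, is_min U m && (sources U o == [set m])].

(* The k-th pair [t k] is (V_k, gamma_k), with k counted from 0; thus the
   indices k in [i] are those with [k < i]. *)
Definition admissible (i j : nat)
    (t : {ffun 'I_(i + j) -> {set 'I_n} * {set 'I_n * 'I_n}}) : bool :=
  [&& [forall k, forall l, (k != l) ==> [disjoint (t k).1 & (t l).1]],
      \bigcup_k (t k).1 == [set: 'I_n],
      [forall k, acyclic_orientation (induced_edge e (t k).1) (t k).2]
    & [forall k : 'I_(i + j), (k < i)%N ==> min_unique_source (t k).1 (t k).2]].

End Tuples.

Arguments admissible [n] e i j t.

(* Main.v *)
From HB Require Import structures.
From mathcomp Require Import all_boot all_order all_algebra.
Require Import Defs.

(* Integer-valued functions of a vertex set form a commutative ring under the
   product (A * B)(U) = sum over W in U of A(W) B(U - W).  If I is the indicator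
   of the independent sets, then chi_G[U](q) = I^q (U) for q natural.  Hence,
   with L(U) = chi'_G[U](0), comparing chi(p + q) = chi(p) chi(q) to first order
   at p = 0 gives chi' = L chi, so the i-th derivative at -j is L^i (I^-1)^j.
   Let s be the automorphism multiplying A(U) by (-1)^|U|.  Two bijections
   remain.
   - I * s(a) = 1, where a counts acyclic orientations: expand over the pairs of
     an acyclic orientation and a subset of its sources; the alternating sum
     over subsets of the nonempty set of sources vanishes.
   - d a = c * a, where d restricts a function to the sets containing v and c
     counts acyclic orientations with v as unique source: split an acyclic
     orientation into the vertices reachable from v and the others.
   Since d is a derivation, d L = d I * I^-1 and the second identity gives
   s(c) = - d L.  So (-1)^n times L^i (I^-1)^j is (-1)^i times the function
   counting the tuples of the theorem. *)

Set Implicit Arguments.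
Unset Strict Implicit.
Unset Printing Implicit Defensive.

Import GRing.Theory Num.Theory.
Local Open Scope ring_scope.

(** * The subset convolution ring *)

Section SetAlgebra.

Variable T : finType.

(* A separate name, because finite functions into a ring already carry the
   pointwise product. *)
Definition setfun := {ffun {set T} -> int}.
HB.instance Definition _ := GRing.Zmodule.on setfun.

Implicit Types (A B C : setfun) (U W : {set T}).

Definition setfun_one : setfun := [ffun U => (U == set0)%:R].

Definition setfun_mul A B : setfun :=
  [ffun U : {set T} => \sum_(W : {set T} | W \subset U) A W * B (U :\: W)].

Lemma setfun_mulC : commutative setfun_mul.
Proof.
move=> A B; apply/ffunP => U; rewrite !ffunE.
rewrite (reindex_onto (fun W => U :\: W) (fun W => U :\: W)) /=; last first.
  by move=> W WU; rewrite setDDr setDv set0U (setIidPr WU).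
apply: eq_big => [W|W /andP[_ /eqP ->]]; last by rewrite mulrC.
rewrite subsetDl setDDr setDv set0U /=.
by apply/eqP/idP => [<-|/setIidPr//]; rewrite subsetIl.
Qed.

(** Both sides sum over the ordered partitions of [U] into three possibly empty blocks;
    [Y = W :|: Z], with [Z] disjoint from [W], matches the two indexings. *)
Lemma setfun_mulA : associative setfun_mul.
Proof.
move=> A B C; apply/ffunP => U; rewrite !ffunE.
under [RHS]eq_bigr => Y _ do rewrite ffunE mulr_suml.
rewrite (exchange_big_dep (fun W => W \subset U)) /=; last first.
  by move=> Y W YU WY; apply: subset_trans YU.
apply: eq_bigr => W WU; rewrite ffunE mulr_sumr.
rewrite [RHS](reindex_onto (fun Z => W :|: Z) (fun Y => Y :\: W)) /=; last first.
  by move=> Y /andP[_ WY]; rewrite -{1}(setIidPr WY) setID.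
apply: eq_big => [Z|Z].
  rewrite subsetUl subUset WU /= andbT setDUl setDv set0U subsetD.
  congr (_ && _); apply/idP/eqP => [/setDidPl //|<-].
  by rewrite -setI_eq0 setIC setIDA setIC setDIl setDv setI0.
rewrite subsetD setDUl setDv set0U => /andP[_ /setDidPl ZW].
by rewrite ZW mulrA setDDl.
Qed.

Lemma setfun_mul1 : left_id setfun_one setfun_mul.
Proof.
move=> A; apply/ffunP => U; rewrite ffunE (bigD1 set0) ?sub0set //=.
rewrite ffunE eqxx mul1r setD0 big1 ?addr0 // => W /andP[_ /negPf W0].
by rewrite ffunE W0 mul0r.
Qed.

Lemma setfun_mulDl : left_distributive setfun_mul +%R.
Proof.
move=> A B C; apply/ffunP => U; rewrite !ffunE -big_split.
by apply: eq_bigr => W _; rewrite ffunE mulrDl.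
Qed.

Lemma setfun_one_neq0 : setfun_one != 0.
Proof. by apply/eqP => /ffunP/(_ set0); rewrite !ffunE eqxx. Qed.

HB.instance Definition _ := GRing.Zmodule_isComNzRing.Build setfun
  setfun_mulA setfun_mulC setfun_mul1 setfun_mulDl setfun_one_neq0.

Lemma setfun1E U : (1 : setfun) U = (U == set0)%:R.
Proof. by rewrite ffunE. Qed.

Lemma setfunME A B U :
  (A * B) U = \sum_(W : {set T} | W \subset U) A W * B (U :\: W).
Proof. by rewrite ffunE. Qed.

Lemma setfunNE A U : (- A) U = - A U.
Proof. by rewrite ffunE. Qed.

Definition setfun_sign A : setfun := [ffun U : {set T} => (-1) ^+ #|U| * A U].

Lemma setfun_sign_nmod : nmod_morphism setfun_sign.
Proof.
split=> [|A B]; apply/ffunP => U; rewrite !ffunE ?mulr0 //.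
by rewrite mulrDr.
Qed.
HB.instance Definition _ :=
  GRing.isNmodMorphism.Build setfun setfun setfun_sign setfun_sign_nmod.

Lemma setfun_sign_monoid : monoid_morphism setfun_sign.
Proof.
split=> [|A B]; apply/ffunP => U; rewrite !ffunE.
  by case: (U =P set0) => [->|_]; rewrite ?cards0 ?mulr0.
rewrite mulr_sumr; apply: eq_bigr => W WU; rewrite !ffunE mulrACA -exprD.
by rewrite -(cardsID W U) (setIidPr WU).
Qed.
HB.instance Definition _ :=
  GRing.isMonoidMorphism.Build setfun setfun setfun_sign setfun_sign_monoid.

Lemma setfun_signK : involutive setfun_sign.
Proof.
by move=> A; apply/ffunP => U; rewrite !ffunE mulrA -signr_odd -signr_addb addbb mul1r.
Qed.

(* On the generating function of A, with one variable per vertex, this is the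
   derivation x_v d/dx_v. *)
Definition setfun_at (v : T) A : setfun := [ffun U : {set T} => (v \in U)%:R * A U].

(** A vertex [v] of [U] lies in exactly one of [W] and [U :\: W]. *)
Lemma setfun_atM v A B :
  setfun_at v (A * B) = setfun_at v A * B + A * setfun_at v B.
Proof.
apply/ffunP => U; rewrite !ffunE mulr_sumr -big_split; apply: eq_bigr => W WU /=.
rewrite !ffunE inE; case: (boolP (v \in W)) => [/(subsetP WU) ->|_] /=.
  by rewrite !mul1r mul0r mulr0 addr0.
by rewrite !mul0r add0r mulrCA.
Qed.

Lemma setfun_at1 v : setfun_at v 1 = 0.
Proof.
apply/ffunP => U; rewrite !ffunE.
by case: (U =P set0) => [->|_]; rewrite ?inE ?mul0r ?mulr0.
Qed.

(** The power rule, with the power of exponent [n - 1] written as [B * A ^+ n]: no predecessor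
    appears, and [n] can later become a polynomial variable. *)
Lemma setfun_atX v A B n : A * B = 1 ->
  setfun_at v (A ^+ n) = (setfun_at v A * B * A ^+ n) *+ n.
Proof.
move=> AB; elim: n => [|n IHn]; first by rewrite setfun_at1.
rewrite exprS setfun_atM IHn mulrnAr mulrS; congr (_ + _ *+ _).
  by rewrite mulrA -[_ * B * A]mulrA [B * A]mulrC AB mulr1.
by rewrite mulrCA.
Qed.

Lemma setfun_at_inv v A B : A * B = 1 ->
  setfun_at v B = - (setfun_at v A * B * B).
Proof.
move=> AB; have /eqP := setfun_atM v A B.
rewrite AB setfun_at1 eq_sym addrC addr_eq0 => /eqP AdB.
by rewrite -mulNr -AdB mulrAC AB mul1r.
Qed.

End SetAlgebra.

(** * Ordered partitions and colorings *)

Section DecoratedPartitions.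

Variables (T O : finType).

(** Blocks may be empty, and the condition depends on the position. With [O = unit] these are the
    color classes of colorings; with arc sets as decorations, the tuples of the theorem. *)
Definition decorated_partitions m (P : nat -> {set T} -> pred O) (U : {set T})
    : {set {ffun 'I_m -> {set T} * O}} :=
  [set t : {ffun 'I_m -> {set T} * O} |
    [&& [forall k, forall l, (k != l) ==> [disjoint (t k).1 & (t l).1]],
        \bigcup_k (t k).1 == U & [forall k : 'I_m, P k (t k).1 (t k).2]]].

Definition ffun_cons (X : Type) m (p : X * {ffun 'I_m -> X})
    : {ffun 'I_m.+1 -> X} :=
  [ffun k => if unlift ord0 k is Some l then p.2 l else p.1].

Lemma ffun_cons0 (X : Type) m (p : X * {ffun 'I_m -> X}) :
  ffun_cons p ord0 = p.1.
Proof. by rewrite ffunE unlift_none. Qed.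

Lemma ffun_consS (X : Type) m (p : X * {ffun 'I_m -> X}) k :
  ffun_cons p (lift ord0 k) = p.2 k.
Proof. by rewrite ffunE liftK. Qed.

Lemma ffun_cons_bij (X : Type) m : bijective (@ffun_cons X m).
Proof.
exists (fun t : {ffun 'I_m.+1 -> X} => (t ord0, [ffun k => t (lift ord0 k)])).
  move=> [x t]; rewrite ffun_cons0; congr (_, _).
  by apply/ffunP => k; rewrite ffunE ffun_consS.
move=> t; apply/ffunP => k; rewrite ffunE.
by case: unliftP => [l|] -> //=; rewrite ffunE.
Qed.

Lemma decorated_partitionsS m (P : nat -> {set T} -> pred O) U x
    (t : {ffun 'I_m -> {set T} * O}) :
  (ffun_cons (x, t) \in decorated_partitions m.+1 P U) =
  [&& x.1 \subset U, P 0%N x.1 x.2 &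
      t \in decorated_partitions m (fun k => P k.+1) (U :\: x.1)].
Proof.
rewrite !inE big_ord_recl ffun_cons0 /=.
under eq_bigr => k _ do rewrite ffun_consS /=.
have -> : [forall k : 'I_m.+1, P k (ffun_cons (x, t) k).1 (ffun_cons (x, t) k).2]
          = P 0%N x.1 x.2 && [forall k : 'I_m, P k.+1 (t k).1 (t k).2].
  apply/forallP/andP => [H|[P0 /forallP H] k].
    split; first by have := H ord0; rewrite ffun_cons0.
    by apply/forallP => k; have := H (lift ord0 k); rewrite ffun_consS.
  case: (unliftP ord0 k) => [l|] ->; first by rewrite ffun_consS; apply: H.
  by rewrite ffun_cons0.
have -> : [forall k, forall l, (k != l) ==>
             [disjoint (ffun_cons (x, t) k).1 & (ffun_cons (x, t) l).1]]
  = [forall k, forall l, (k != l) ==> [disjoint (t k).1 & (t l).1]]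
    && [disjoint x.1 & \bigcup_k (t k).1].
  apply/forallP/andP => [H|[/forallP H D] k].
    split.
      apply/forallP => k; apply/forallP => l.
      by have /forallP/(_ (lift ord0 l)) := H (lift ord0 k);
         rewrite !ffun_consS (inj_eq lift_inj).
    apply/bigcup_disjointP => k _.
    by have /forallP/(_ (lift ord0 k)) := H ord0; rewrite ffun_consS ffun_cons0.
  have {}D l : [disjoint x.1 & (t l).1].
    by move/bigcup_disjointP: D => ->.
  apply/forallP => l.
  case: (unliftP ord0 k) => [k'|] ->; case: (unliftP ord0 l) => [l'|] ->;
    rewrite ?ffun_consS ?ffun_cons0 ?(inj_eq lift_inj) ?eqxx //=.
  - by have /forallP/(_ l') := H k'.
  - by rewrite disjoint_sym D.
set V := \bigcup_k _; set D := [disjoint _ & _].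
(* The covering of [U] and disjointness from the first block together say that the other blocks
   cover exactly the rest; [H] only rearranges conjuncts. *)
suff: D && (x.1 :|: V == U) = (x.1 \subset U) && (V == U :\: x.1).
  have H (a d u p b s v : bool) : d && u = s && v ->
    [&& a && d, u, p & b] = [&& s, p & [&& a, v & b]].
    by case: a d u p b s v => -[] [] [] [] [] [].
  exact: H.
apply/andP/andP => [[D' /eqP <-]|[xU /eqP VE]].
  rewrite subsetUl setDUl setDv set0U; move: D'.
  by rewrite /D disjoint_sym => /setDidPl ->.
split; first by rewrite /D VE -setI_eq0 setIDA setDIl setDv set0I.
by rewrite VE -{1}(setIidPr xU) setID.
Qed.

(** Induction on [m]: the choice of the first block is one convolution, and the empty tuple
    partitions only the empty set. *)
Lemma card_decorated_partitions m (P : nat -> {set T} -> pred O) U :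
  #|decorated_partitions m P U|%:R =
  (\prod_(k < m) ([ffun W => #|[set o | P k W o]|%:R] : setfun T)) U.
Proof.
elim: m P U => [|m IHm] P U.
  rewrite big_ord0 setfun1E.
  have [->|U0] := eqVneq U set0.
    rewrite (_ : decorated_partitions _ _ _ = setT) ?cardsT ?card_ffun ?card_ord //.
    by apply/setP => t; rewrite !inE big_ord0 eqxx /=; apply/andP; split;
       apply/forallP => -[].
  rewrite (_ : decorated_partitions _ _ _ = set0) ?cards0 //.
  by apply/setP => t; rewrite !inE big_ord0 eq_sym (negPf U0) !andbF.
rewrite big_ord_recl setfunME -sum1_card.
under [in RHS]eq_bigr => W _ do under [in X in _ * X]eq_bigr => k _ do rewrite lift0.
rewrite (reindex _ (onW_bij _ (@ffun_cons_bij _ m))) /=.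
pose D W := decorated_partitions m (fun k => P k.+1) (U :\: W).
rewrite (eq_bigl (fun p : ({set T} * O) * {ffun 'I_m -> {set T} * O} =>
  ((p.1.1 \subset U) && P 0%N p.1.1 p.1.2) && (p.2 \in D p.1.1))); last first.
  by move=> [x t]; rewrite decorated_partitionsS andbA.
rewrite -(pair_big_dep (fun x : {set T} * O => (x.1 \subset U) && P 0%N x.1 x.2)
  (fun x t => t \in D x.1) (fun _ _ => 1%N)) /=.
rewrite -(pair_big_dep (fun W : {set T} => W \subset U) (P 0%N)
  (fun W _ => \sum_(t in D W) 1%N)) /= natr_sum.
apply: eq_bigr => W WU; rewrite ffunE -(IHm (fun k => P k.+1)).
rewrite sum_nat_const sum1_card natrM.
by congr (_%:R * _); apply: eq_card => o; rewrite inE.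
Qed.
End DecoratedPartitions.

Section Colorings.

Variables (S T : finType) (h : S -> T) (e : rel T).

Definition independent (W : {set T}) := [forall u in W, forall v in W, ~~ e u v].

Definition setfun_indep : setfun T := [ffun W => (independent W)%:R].

(** Color classes form an ordered partition into [q] independent sets. The injection [h] covers both
    induced subgraphs ([val]) and the whole graph (the identity). *)
Lemma card_proper_coloring q : injective h ->
  #|[set f : {ffun S -> 'I_q} | proper_coloring (relpre h e) f]|%:R =
  (setfun_indep ^+ q) (h @: setT).
Proof.
move=> h_inj.
pose phi (f : {ffun S -> 'I_q}) : {ffun 'I_q -> {set T} * unit} :=
  [ffun k => (h @: [set x | f x == k], tt)].
have phiE f k x : (h x \in (phi f k).1) = (f x == k).
  by rewrite ffunE mem_imset // inE.
have phi_inj : injective phi.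
  by move=> f g E; apply/ffunP => x; apply/eqP; rewrite eq_sym -phiE -E phiE.
have -> : setfun_indep ^+ q = \prod_(k < q) ([ffun W : {set T} =>
    #|[set o : unit | independent W]|%:R] : setfun T).
  rewrite prodr_const card_ord; congr (_ ^+ _); apply/ffunP => W; rewrite !ffunE.
  move: (independent W) => [] /=; rewrite cardsE; last by rewrite eq_card0.
  by rewrite (eq_card (B := predT)) ?card_unit.
rewrite -(card_decorated_partitions q (fun _ W (_ : unit) => independent W)).
rewrite -(card_imset _ phi_inj); congr (_%:R); apply: eq_card => t.
apply/imsetP/idP => [[f + ->]|].
  rewrite !inE => /forallP fP; apply/and3P; split.
  - apply/forallP => k; apply/forallP => l; apply/implyP => kl.
    rewrite -setI_eq0; apply/eqP/setP => y; rewrite !inE !ffunE /=.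
    apply/negP => /andP[/imsetP[x + ->]]; rewrite mem_imset // !inE.
    by move=> /eqP -> /eqP kl'; rewrite kl' eqxx in kl.
  - apply/eqP/setP => y; apply/bigcupP/imsetP => [[k _]|[x _ ->]].
      by rewrite ffunE /= => /imsetP[x _ ->]; exists x; rewrite ?inE.
    by exists (f x); rewrite ?phiE.
  - apply/forallP => k; rewrite ffunE /=.
    apply/forall_inP => _ /imsetP[x + ->]; rewrite inE => /eqP fx.
    apply/forall_inP => _ /imsetP[y + ->]; rewrite inE => /eqP fy.
    by have /forallP/(_ y)/implyP := fP x; rewrite fx fy eqxx => /contraNN; apply.
rewrite inE => /and3P[/forallP dis /eqP cov /forallP ind].
(* Covering gives each vertex a color and disjointness makes it unique, so every partition is a
   [phi f]. *)
have /fin_all_exists[f fP] x : exists k, h x \in (t k).1.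
  have : h x \in \bigcup_k (t k).1 by rewrite cov imset_f.
  by case/bigcupP => k _ xk; exists k.
have fE x k : (h x \in (t k).1) = (f x == k).
  apply/idP/eqP => [xk|<-//]; apply/eqP; apply: contraTT xk => fxk.
  by have /forallP/(_ k)/implyP/(_ fxk)/disjointFr -> := dis (f x).
exists (finfun f).
  rewrite inE; apply/forallP => x; apply/forallP => y; apply/implyP => exy.
  rewrite !ffunE; apply/negP => /eqP fxy.
  have /forall_inP/(_ (h x) (fP x))/forall_inP/(_ (h y)) := ind (f x).
  by rewrite fE -fxy eqxx; move: exy => /= -> /(_ isT).
apply/ffunP => k; rewrite ffunE [LHS]surjective_pairing.
congr (_, _); last by case: (t k).2.
apply/setP => y; apply/idP/imsetP => [yt|[x + ->]]; last first.
  by rewrite inE ffunE fE.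
have /imsetP[x _ yE] : y \in h @: setT by rewrite -cov; apply/bigcupP; exists k.
by exists x; rewrite // inE ffunE -fE -yE.
Qed.

End Colorings.

(** * Chromatic polynomials of induced subgraphs *)

Lemma poly_int_ext (p q : {poly int}) :
  (forall n : nat, p.[n%:R] = q.[n%:R]) -> p = q.
Proof.
move=> pq; apply/eqP; rewrite -subr_eq0; apply/contraT => nz.
have := @max_poly_roots _ (p - q) [seq n%:R | n <- iota 0 (size (p - q))] nz.
rewrite size_map size_iota ltnn; apply.
  by apply/allP => _ /mapP[k _ ->]; rewrite /root hornerD hornerN pq subrr.
by rewrite map_inj_uniq ?iota_uniq // => a b /eqP; rewrite eqr_nat => /eqP.
Qed.

(** [is_chromatic_poly] only speaks of positive [q], while evaluations at 0 occur below. The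
    deletion-contraction polynomial is correct at every natural number, and by uniqueness it is the
    chromatic polynomial. *)
Lemma chromatic_poly_nat (T : finType) (e : rel T) (q : nat) :
  (chromatic_poly e).[q%:R] =
    #|[set f : {ffun T -> 'I_q} | proper_coloring e f]|%:R.
Proof.
have [p pE] := deletion_contraction
  [seq uv <- enum {: T * T} | e uv.1 uv.2] (fun x : T => erefl (id x)).
have {}pE m : p.[m%:R] = #|[set f : {ffun T -> 'I_m} | proper_coloring e f]|%:R.
  rewrite pE; congr (_%:R); apply: eq_card => f; rewrite !inE.
  rewrite (introT forallP) //=; apply/allP/forallP => [H u|H [u v]].
    apply/forallP => v; apply/implyP => euv.
    by apply: (H (u, v)); rewrite mem_filter euv mem_enum.
  by rewrite mem_filter => /andP[euv _]; have /forallP/(_ v)/implyP := H u; apply.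
by rewrite -(@chromatic_poly_unique _ e p) // => m _.
Qed.

Section InducedChromatic.

Variables (T : finType) (e : rel T).

Definition induced_chromatic (W : {set T}) : {poly int} :=
  chromatic_poly (relpre val e : rel {x | x \in W}).

Local Notation chi := induced_chromatic.
Local Notation ind := (setfun_indep e).

Lemma induced_chromatic_nat W q : (chi W).[q%:R] = (ind ^+ q) W.
Proof.
rewrite chromatic_poly_nat card_proper_coloring; last exact: val_inj.
congr (_ _); apply/setP => x; apply/imsetP/idP => [[y _ ->]|xW].
  exact: (valP y).
by exists (Sub x xW).
Qed.

Lemma induced_chromaticT : chi setT = chromatic_poly e.
Proof.
apply: poly_int_ext => q; rewrite induced_chromatic_nat chromatic_poly_nat.
rewrite (@card_proper_coloring _ _ id) //; congr (_ _).
by apply/setP => x; rewrite inE; apply/esym/imsetP; exists x.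
Qed.

Definition chromatic_eval (x : int) : setfun T := [ffun W => (chi W).[x]].
Definition chromatic_linear : setfun T := [ffun W => (chi W)^`().[0]].

Lemma chromatic_eval_nat q : chromatic_eval q%:R = ind ^+ q.
Proof. by apply/ffunP => W; rewrite ffunE induced_chromatic_nat. Qed.

(** At a natural number [p] this is [ind ^+ (p + q) = ind ^+ p * ind ^+ q], with [q] fixed and [p]
    the variable. *)
Lemma induced_chromatic_shift U q :
  chi U \Po ('X + q%:R%:P) =
  \sum_(W : {set T} | W \subset U) (ind ^+ q) (U :\: W) *: chi W.
Proof.
apply: poly_int_ext => p; rewrite horner_comp !hornerE horner_sum.
rewrite -natrD induced_chromatic_nat exprD setfunME.
by apply: eq_bigr => W _; rewrite hornerZ induced_chromatic_nat mulrC.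
Qed.

Lemma deriv_induced_chromatic U :
  (chi U)^`() =
  \sum_(W : {set T} | W \subset U) chromatic_linear W *: chi (U :\: W).
Proof.
apply: poly_int_ext => q; rewrite horner_sum.
(* Differentiating the shift identity at 0 gives the wanted values at [q]. *)
have /(congr1 (fun p : {poly int} => p^`().[0])) := induced_chromatic_shift U q.
rewrite deriv_comp derivD derivX derivC addr0 mulr1 horner_comp !hornerE.
move=> ->; rewrite raddf_sum horner_sum; apply: eq_bigr => W _.
by rewrite /= derivZ !hornerZ ffunE induced_chromatic_nat mulrC.
Qed.

Lemma derivn_induced_chromatic U i x :
  ((chi U)^`(i)).[x] = (chromatic_linear ^+ i * chromatic_eval x) U.
Proof.
elim: i U => [|i IHi] U; first by rewrite mul1r ffunE.
rewrite derivSn deriv_induced_chromatic raddf_sum horner_sum exprS -mulrA.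
by rewrite setfunME; apply: eq_bigr => W _; rewrite /= derivnZ hornerZ IHi.
Qed.

(** The shift by 1, at the point -(j+1), says that multiplication by [ind] takes the values at
    -(j+1) to those at -j; multiplication by [A] undoes it. *)
Lemma chromatic_eval_neg (A : setfun T) j :
  ind * A = 1 -> chromatic_eval (- j%:R) = A ^+ j.
Proof.
move=> indA; elim: j => [|j IHj]; first by rewrite oppr0 -[0]/(0%:R) chromatic_eval_nat.
rewrite exprS -IHj -[LHS]mul1r -indA [ind * _]mulrC -mulrA; congr (_ * _); rewrite mulrC.
apply/ffunP => U; rewrite !ffunE.
have /(congr1 (horner^~ (- j.+1%:R))) := induced_chromatic_shift U 1.
rewrite horner_comp horner_sum !hornerE mulrSr opprD -addrA addNr addr0 => ->.
by apply: eq_bigr => W _; rewrite hornerZ expr1 mulrC [chromatic_eval _ W]ffunE.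
Qed.

(** The power rule for [ind ^+ q] carries a factor [q], which becomes ['X] in an identity of
    polynomials; comparing linear coefficients gives the claim. *)
Lemma chromatic_linear_at v (A : setfun T) : ind * A = 1 ->
  setfun_at v chromatic_linear = setfun_at v ind * A.
Proof.
move=> indA; set D := _ * A; apply/ffunP => U.
have chiE : (v \in U)%:R *: chi U =
    'X * \sum_(W : {set T} | W \subset U) D W *: chi (U :\: W).
  apply: poly_int_ext => q; rewrite hornerZ hornerM hornerX horner_sum.
  under [in RHS]eq_bigr => W _ do rewrite hornerZ induced_chromatic_nat.
  rewrite -setfunME induced_chromatic_nat.
  have /(congr1 (fun B : setfun T => B U)) := setfun_atX v q indA.
  by rewrite ffunE => ->; rewrite ffunMnE mulr_natl.
(* The derivative of ['X * F] at 0 is the value of [F] at 0, and there the chromatic polynomials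
   form [ind ^+ 0 = 1]. *)
rewrite ffunE [chromatic_linear U]ffunE -hornerZ -derivZ chiE.
rewrite derivM derivX mul1r hornerD hornerM hornerX mul0r addr0 horner_sum.
rewrite -[D in RHS]mulr1 setfunME; apply: eq_bigr => W _.
by rewrite hornerZ -[0]/(0%:R) induced_chromatic_nat.
Qed.

End InducedChromatic.

(** * Acyclic orientations *)

Section AcyclicOrientations.

Variables (T : finType) (e : rel T).
Implicit Types (U V W X : {set T}) (o : {set T * T}).

Lemma acyclic_connect o u v :
  acyclic o -> arc o u v -> ~~ connect (arc o) v u.
Proof.
move=> /acyclicP ac uv; apply/negP => /connectP[p pth uE].
case: (shortenP pth) uE => p' pth' uniq_p' _ uE.
have /ac // : ucycle (arc o) (v :: p').
by rewrite /ucycle uniq_p' /= rcons_path pth' -uE uv.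
Qed.

(** This form of acyclicity passes easily to restricted and glued orientations. *)
Lemma acyclic_source o :
  acyclic o <-> forall X, X != set0 ->
    exists2 v, v \in X & forall u, u \in X -> (u, v) \notin o.
Proof.
split=> [ac X /set0Pn[x0 x0X]|src].
  (* A vertex of [X] with fewest ancestors works: an arc from [u] to [v] would make the ancestors of
     [u] a proper subset of those of [v], as [v] does not reach [u]. *)
  pose h v := #|[set u | connect (arc o) u v]|.
  case: (arg_minnP h x0X) => v vX hmin; exists v => // u uX.
  apply/negP => uv; have := hmin u uX; rewrite leqNgt => /negP[].
  apply: proper_card; apply/properP; split.
    apply/subsetP => w; rewrite !inE => wu; apply: connect_trans wu _.
    exact: connect1.
  by exists v; rewrite !inE ?connect0 // acyclic_connect.
(* In a cycle every vertex has an arc from its predecessor, so its vertex set has no source. *)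
apply/acyclicP => c /andP[cyc _]; apply/eqP/contraT => c0.
have [|v vc src_v] := src [set x in c].
  by case: c c0 {cyc} => // x c _; apply/set0Pn; exists x; rewrite !inE eqxx.
rewrite inE in vc; have := src_v (prev c v).
by rewrite inE mem_prev vc -[(_, _) \in o]/(arc o _ _) (prev_cycle cyc vc) => /(_ isT).
Qed.

Definition acyclic_orientations U : {set {set T * T}} :=
  [set o | acyclic_orientation (induced_edge e U) o].

Definition unique_source_orientations U v :=
  [set o in acyclic_orientations U | sources U o == [set v]].

Lemma acyclic_orientationsP U o :
  reflect [/\ forall u v, ((u, v) \in o) || ((v, u) \in o)
                            = [&& u \in U, v \in U & e u v],
              forall u v, ~~ (((u, v) \in o) && ((v, u) \in o)) & acyclic o]
    (o \in acyclic_orientations U).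
Proof.
rewrite inE; apply: (iffP andP) => [[/forallP H ac]|[H1 H2 ac]]; split=> //.
- by move=> u v; have /forallP/(_ v)/andP[/eqP] := H u.
- by move=> u v; have /forallP/(_ v)/andP[_] := H u.
by apply/forallP => u; apply/forallP => v; rewrite /= H1 H2 eqxx.
Qed.

Lemma mem_acyclic_orientations U o u v : o \in acyclic_orientations U ->
  (u, v) \in o = [&& u \in U, v \in U & (u, v) \in o].
Proof.
case/acyclic_orientationsP => H _ _.
case: (boolP (_ \in o)) => [uv|]; last by rewrite !andbF.
by have := H u v; rewrite uv => /esym/and3P[-> ->].
Qed.

Definition restrict_arcs W o := [set p in o | (p.1 \in W) && (p.2 \in W)].

Lemma restrict_arcs_orientation U W o : W \subset U ->
  o \in acyclic_orientations U -> restrict_arcs W o \in acyclic_orientations W.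
Proof.
move=> /subsetP WU /acyclic_orientationsP[or asym /acyclic_source src].
apply/acyclic_orientationsP; split=> [u v|u v|].
- have := or u v; rewrite !inE /=.
  have [uW|_] := boolP (u \in W); have [vW|_] := boolP (v \in W); rewrite ?andbF //=.
  by rewrite !andbT !WU.
- by apply: contraNN (asym u v); rewrite !inE => /andP[/andP[-> _] /andP[-> _]].
apply/acyclic_source => X /src[v vX Hv]; exists v => // u uX.
by rewrite inE negb_and Hv.
Qed.

Definition glue_arcs V W (oo : {set T * T} * {set T * T}) :=
  oo.1 :|: oo.2 :|: [set p | [&& p.1 \in V, p.2 \in W & e p.1 p.2]].

Hypothesis e_sym : symmetric e.

(** Edges between the parts point from [V] to [W]. So a set meeting [V] has a source inside [V], and
    any other set gets one from [o2]. *)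
Lemma glue_arcs_orientation V W o1 o2 : [disjoint V & W] ->
  o1 \in acyclic_orientations V -> o2 \in acyclic_orientations W ->
  glue_arcs V W (o1, o2) \in acyclic_orientations (V :|: W).
Proof.
move=> dis oV oW; have disF u : u \in W -> u \in V = false by apply: disjointFl.
have [or1 as1 /acyclic_source src1] := acyclic_orientationsP _ _ oV.
have [or2 as2 /acyclic_source src2] := acyclic_orientationsP _ _ oW.
have disb u : ~~ ((u \in V) && (u \in W)).
  by apply/negP => /andP[uV uW]; rewrite disF in uV.
apply/acyclic_orientationsP; split=> [u v|u v|].
(* Check over nine booleans: four endpoint memberships, four arcs and one edge. *)
- move: (disb u) (disb v) (or1 u v) (or2 u v); rewrite !inE /= [e v u]e_sym.
  by do 9!case: (_ \in _) || case: (e u v).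
- move: (disb u) (disb v) (or1 u v) (or2 u v) (as1 u v) (as2 u v).
  rewrite !inE /= [e v u]e_sym.
  by do 9!case: (_ \in _) || case: (e u v).
apply/acyclic_source => X X0.
have [XW|] := boolP (X :&: V == set0).
  have [v vX Hv] := src2 X X0; exists v => // u uX.
  have nV w : w \in X -> w \in V = false.
    by move=> wX; move/eqP/setP/(_ w): XW; rewrite !inE wX.
  by rewrite !inE /= (negPf (Hv u uX)) (mem_acyclic_orientations _ _ oV) (nV u uX).
move=> /src1[v]; rewrite inE => /andP[vX vV] Hv; exists v => // u uX.
have vW : v \in W = false by apply/negP => /disF; rewrite vV.
rewrite !inE /= (mem_acyclic_orientations _ _ oW) vW !andbF !orbF.
rewrite (mem_acyclic_orientations _ _ oV).
by apply/negP => /and3P[uV _]; apply/negP/Hv; rewrite inE uX.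
Qed.

Definition no_arcs o W V := [forall p in o, ~~ ((p.1 \in W) && (p.2 \in V))].

(** Gluing and restricting are mutually inverse: without arcs from [W] to [V], every edge between
    them has a forced direction. [Q] leaves room for a condition on the part in [W]. *)
Lemma card_glued_orientations V W (Q : pred {set T * T}) : [disjoint V & W] ->
  #|[set o in acyclic_orientations (V :|: W) | no_arcs o W V && Q (restrict_arcs W o)]|
  = (#|acyclic_orientations V| * #|[set o in acyclic_orientations W | Q o]|)%N.
Proof.
move=> dis; rewrite -cardsX.
have disF u : u \in W -> u \in V = false by apply: disjointFl.
have disF' u : u \in V -> u \in W = false by apply: disjointFr.
pose split_arcs o := (restrict_arcs V o, restrict_arcs W o).
have glueK oo : oo \in setX (acyclic_orientations V) (acyclic_orientations W) ->
    split_arcs (glue_arcs V W oo) = oo.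
  case: oo => o1 o2; rewrite inE /= => /andP[oV oW]; congr (_, _);
    apply/setP => -[u v]; rewrite !inE /=.
  - rewrite (mem_acyclic_orientations _ _ oW) [RHS](mem_acyclic_orientations _ _ oV).
    case: (boolP (u \in V)) => uV; rewrite ?andbF //=.
    case: (boolP (v \in V)) => vV; rewrite ?andbF //=.
    by rewrite (disF' u uV) (disF' v vV) /= !orbF andbT.
  - rewrite (mem_acyclic_orientations _ _ oV) [RHS](mem_acyclic_orientations _ _ oW).
    case: (boolP (u \in W)) => uW; rewrite ?andbF //=.
    case: (boolP (v \in W)) => vW; rewrite ?andbF //=.
    by rewrite (disF u uW) (disF v vW) /= orbF andbT.
rewrite -(card_in_imset (f := glue_arcs V W)); last first.
  have sub oo : oo \in setX (acyclic_orientations V)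
      [set o in acyclic_orientations W | Q o] ->
      oo \in setX (acyclic_orientations V) (acyclic_orientations W).
    by case: oo => o1 o2; rewrite !in_setX => /andP[-> /setIdP[]].
  by move=> x y /sub/glueK xK /sub/glueK yK E; rewrite -xK E yK.
apply: eq_card => o; apply/setIdP/imsetP.
  case=> oU /andP[/forall_inP noWV Qo].
  exists (split_arcs o).
    rewrite in_setX; apply/andP; split.
      by apply: restrict_arcs_orientation oU; apply: subsetUl.
    apply/setIdP; split=> //.
    by apply: restrict_arcs_orientation oU; apply: subsetUr.
  apply/setP => -[u v]; rewrite !inE /=.
  have [or _ _] := acyclic_orientationsP _ _ oU.
  move: (or u v) (noWV (u, v)) (noWV (v, u)) (mem_acyclic_orientations u v oU).
  rewrite !inE /=.
  have disb w : ~~ ((w \in V) && (w \in W)).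
    by apply/negP => /andP[wV wW]; rewrite disF in wV.
  move: (disb u) (disb v).
  case: (u \in V); case: (v \in V); case: (u \in W); case: (v \in W);
    case: (_ \in o); case: (_ \in o); case: (e u v) => //= *; by intuition.
case=> -[o1 o2]; rewrite in_setX => /andP[oV /setIdP[oW Qo]] ->; split.
  exact: glue_arcs_orientation.
have /(congr1 snd) /= -> : split_arcs (glue_arcs V W (o1, o2)) = (o1, o2).
  by apply: glueK; rewrite in_setX oV.
rewrite Qo andbT; apply/forall_inP => -[u v].
rewrite !inE /= (mem_acyclic_orientations _ _ oV) (mem_acyclic_orientations _ _ oW).
case: (boolP (u \in W)) => // uW; case: (boolP (v \in V)) => // vV.
by rewrite (disF u uW) (disF' v vV).
Qed.

End AcyclicOrientations.

(** * Acyclic orientations in the convolution ring *)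

Lemma sum_sign_subsets (T : finType) (X : {set T}) :
  \sum_(S : {set T} | S \subset X) (-1) ^+ #|S| = (X == set0)%:R :> int.
Proof.
have [->|/set0Pn[x xX]] := eqVneq X set0.
  by rewrite (big_pred1 set0) ?cards0 // => S; rewrite subset0.
(* Adding the fixed element [x] pairs the subsets avoiding it with those containing it, with
   opposite signs. *)
rewrite (bigID (fun S : {set T} => x \in S)) /=.
rewrite (reindex_onto (fun S => x |: S) (fun S => S :\ x)) /=; last first.
  by move=> S /andP[_ xS]; rewrite setD1K.
rewrite -[RHS](addNr (\sum_(S : {set T} | (S \subset X) && (x \notin S)) (-1) ^+ #|S|)).
congr (_ + _); rewrite -sumrN; apply: eq_big => [S|S /andP[_ /eqP <-]].
  rewrite setU11 andbT subUset sub1set xX /=; congr (_ && _).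
  by apply/eqP/idP => [<-|xS]; rewrite ?setD11 ?setU1K.
by rewrite setD1K ?setU11 // [in LHS](cardsD1 x) setU11 exprS mulN1r.
Qed.

Section AcyclicSeries.

Variables (T : finType) (e : rel T).
Implicit Types (U W S R : {set T}) (o : {set T * T}).
Hypothesis e_sym : symmetric e.

Local Notation AO := (acyclic_orientations e).
Local Notation ind := (setfun_indep e).

Lemma sourcesP U o v :
  reflect (v \in U /\ forall u, (u, v) \notin o) (v \in sources U o).
Proof. by rewrite inE; apply: (iffP andP) => -[vU /forallP]. Qed.

Lemma acyclic_orientations_independent S : independent e S -> AO S = [set set0].
Proof.
move=> /forall_inP ind_S; apply/setP => o; rewrite in_set1.
have ne u v : [&& u \in S, v \in S & e u v] = false.
  apply/negP => /and3P[uS vS euv].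
  by have /forall_inP/(_ v vS) := ind_S u uS; rewrite euv.
apply/acyclic_orientationsP/eqP => [[or _ _]|->].
  by apply/setP => -[u v]; rewrite inE; have := or u v; rewrite ne; case: (_ \in o).
split=> [u v|u v|]; rewrite ?inE ?ne //.
by apply/acyclic_source => X /set0Pn[v vX]; exists v => // u _; rewrite inE.
Qed.

(** An edge inside [S] gives one of its ends an incoming arc. If [S] is independent, it consists of
    sources exactly when no arc goes from [U :\: S] to [S], and gluing applies. *)
Lemma card_source_orientations U S : S \subset U ->
  #|[set o in AO U | S \subset sources U o]| =
  (independent e S * #|AO (U :\: S)|)%N.
Proof.
move=> SU; have [ind_S|] := boolP (independent e S); last first.
  case/forall_inPn => u uS /forall_inPn[v vS]; rewrite negbK => euv.
  apply/eqP; rewrite cards_eq0; apply/eqP/setP => o; rewrite [RHS]inE.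
  apply/negP => /setIdP[/acyclic_orientationsP[or _ _] /subsetP src].
  have /sourcesP[_ /(_ v) vu] := src u uS; have /sourcesP[_ /(_ u) uv] := src v vS.
  have := or u v; rewrite (negPf vu) (negPf uv) euv !(subsetP SU) //.
have dis : [disjoint S & U :\: S] by rewrite -setI_eq0 setIDA setDIl setDv set0I.
have := card_glued_orientations e_sym predT dis.
rewrite (acyclic_orientations_independent ind_S) cards1.
rewrite (_ : [set o in AO (U :\: S) | predT o] = AO (U :\: S)); last first.
  by apply/setP => o; apply/setIdP/idP => [[]|].
rewrite -{1}(setIidPr SU) setID => <-; apply: eq_card => o.
apply/setIdP/setIdP => -[oU]; rewrite andbT => H; split=> //.
  apply/forall_inP => -[u v] uv; apply/negP => /andP[_ vS].
  by have /sourcesP[_ /(_ u)] := subsetP H v vS; rewrite uv.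
apply/subsetP => v vS; apply/sourcesP; split=> [|u]; first exact: subsetP vS.
apply/negP => uv; have /forall_inP/(_ _ uv) := H; rewrite inE /= vS andbT andbC.
move: uv; rewrite (mem_acyclic_orientations _ _ oU) => /and3P[uU _ uv].
rewrite uU /= negbK => uS.
have /forall_inP/(_ u uS)/forall_inP/(_ v vS) := ind_S.
by case/acyclic_orientationsP: oU => /(_ u v); rewrite uv => /esym/and3P[_ _ ->].
Qed.

Definition setfun_acyclic : setfun T := [ffun U => #|AO U|%:R].

Definition setfun_unique_source v : setfun T :=
  [ffun U => #|unique_source_orientations e U v|%:R].

Lemma setfun_indep_acyclic : ind * setfun_sign setfun_acyclic = 1.
Proof.
(* Applying the involution [setfun_sign] moves the signs onto [ind], where they become the signs of
   the subsets [S]. *)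
rewrite -[ind]setfun_signK -rmorphM -[RHS](rmorph1 (@setfun_sign T)).
congr (setfun_sign _); apply/ffunP => U; rewrite setfunME setfun1E.
transitivity (\sum_(o in AO U)
    \sum_(S : {set T} | S \subset sources U o) (-1) ^+ #|S| : int).
  rewrite (exchange_big_dep (fun S => S \subset U)) /=; last first.
    by move=> o S _ /subset_trans; apply; apply/subsetP => v /sourcesP[].
  apply: eq_bigr => S SU; rewrite !ffunE -mulrA -natrM -card_source_orientations //.
  rewrite mulr_natr -sumr_const; apply: eq_bigl => o.
  by apply/setIdP/andP.
under eq_bigr => o _ do rewrite sum_sign_subsets.
(* On the empty set there is only the empty orientation, without sources. Otherwise every acyclic
   orientation has a source, and its term vanishes. *)
have [U0|U0] := eqVneq U set0.
  rewrite acyclic_orientations_independent ?big_set1; last first.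
    by apply/forall_inP => u; rewrite U0 inE.
  case: eqP => // /eqP/set0Pn[v /sourcesP[]]; by rewrite U0 inE.
apply: big1 => o oU.
have /acyclic_orientationsP[_ _ /acyclic_source/(_ U U0)[v vU Hv]] := oU.
case: eqP => // /setP/(_ v); rewrite [RHS]inE => /negP[]; apply/sourcesP; split=> // u.
by rewrite (mem_acyclic_orientations _ _ oU); apply/negP => /and3P[/Hv/negP].
Qed.

Lemma setfun_at_acyclic v :
  setfun_at v setfun_acyclic = setfun_unique_source v * setfun_acyclic.
Proof.
apply/ffunP => U; rewrite setfunME ffunE [in LHS]ffunE.
pose reach o := [set x | connect (arc o) v x].
(* If [v] is outside [U], it is not a source of any subset of [U], and both sides are zero. *)
have [vU|vU] := boolP (v \in U); last first.
  rewrite mul0r big1 // => R RU; rewrite ffunE [#|_|](_ : _ = 0%N) ?mul0r //.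
  apply/eqP; rewrite cards_eq0; apply/eqP/setP => o; rewrite [RHS]inE.
  apply/negP => /setIdP[_ /eqP/setP/(_ v)]; rewrite !inE eqxx => /andP[/(subsetP RU)].
  by rewrite (negPf vU).
rewrite mul1r -sum1_card natr_sum.
(* Orientations are grouped by the set [R] reachable from [v]. No arc leaves [R], so each is glued
   from [U :\: R] and [R]. *)
rewrite (partition_big reach (fun R => R \subset U)) /=; last first.
  move=> o oU; apply/subsetP => x; rewrite inE => /connectP[p pth ->] {x}.
  case/lastP: p pth => [|p x] //; rewrite last_rcons rcons_path => /andP[_].
  by rewrite -[arc _ _ _]/(_ \in o) (mem_acyclic_orientations _ _ oU) => /and3P[].
apply: eq_bigr => R RU; rewrite !ffunE mulrC -natrM.
have dis : [disjoint U :\: R & R] by rewrite -setI_eq0 setIDAC setDIl setDv setI0.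
rewrite -(card_glued_orientations e_sym (fun o => sources R o == [set v]) dis).
rewrite (_ : U :\: R :|: R = U); last by rewrite setUC -{1}(setIidPr RU) setID.
(* It remains to see that [R] is the reachable set exactly when no arc leaves [R] and [v] is the
   only source of the restriction to [R]. *)
rewrite -sum1_card natr_sum; apply: eq_bigl => o; apply/andP/setIdP => -[oU].
  move=> /eqP reachE; split=> //; apply/andP; split.
    apply/forall_inP => -[x y] xy; apply/negP; rewrite -reachE !inE /= => /and3P[vx + _].
    by rewrite (connect_trans vx (connect1 xy)).
  have ac : acyclic o by case/acyclic_orientationsP: oU.
  apply/eqP/setP => x; rewrite in_set1; apply/sourcesP/eqP => [[]|->].
    rewrite -{1}reachE inE => /connectP[p pth ->].
    case/lastP: p pth => [|p y] //; rewrite last_rcons rcons_path => /andP[pth ly].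
    move=> /(_ (last v p)); rewrite inE /= -[_ \in o]/(arc o _ _) ly -reachE !inE.
    have vl : connect (arc o) v (last v p) by apply/connectP; exists p.
    by rewrite vl (connect_trans vl (connect1 ly)).
  rewrite -reachE inE connect0; split=> // u; rewrite !inE /= connect0 andbT.
  by apply/negP => /andP[uv vu]; have := acyclic_connect ac uv; rewrite vu.
move=> /andP[/forall_inP noRU /eqP/setP src]; split=> //; apply/eqP.
have /sourcesP[vR _] : v \in sources R (restrict_arcs R o) by rewrite src inE.
apply/eqP; rewrite eqEsubset; apply/andP; split; apply/subsetP => x.
  rewrite inE => /connectP[p pth ->] {x}.
  elim/last_ind: p pth => [|p x IHp] //; rewrite last_rcons rcons_path.
  move=> /andP[/IHp lR lx].
  have := noRU _ lx; rewrite !inE /= lR /=.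
  move: lx; rewrite -[arc _ _ _]/(_ \in o).
  by rewrite (mem_acyclic_orientations _ _ oU) => /and3P[_ -> _]; rewrite andbT negbK.
(* The unreached vertices of [R] have a source [w] among themselves. No reached vertex has an arc to
   [w], so [w] is a source of [R], that is [v], which is reached. *)
move=> xR; apply: contraT => x_unreach.
have /acyclic_orientationsP[_ _ /acyclic_source/(_ (R :\: reach o))] := oU.
case=> [|w]; first by apply/set0Pn; exists x; rewrite in_setD x_unreach.
rewrite !inE => /andP[w_unreach wR] Hw.
have : w \in [set v].
  rewrite -src; apply/sourcesP; split=> // u; rewrite inE /=.
  apply/negP => /and3P[uw uR _]; have := Hw u; rewrite !inE uR uw andbT.
  have [vu _|_ /(_ isT)//] := boolP (connect (arc o) v u).
  by rewrite (connect_trans vu (connect1 uw)) in w_unreach.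
by rewrite inE => /eqP wv; rewrite wv connect0 in w_unreach.
Qed.

End AcyclicSeries.

(** * Linear coefficients and unique sources *)

Section ChromaticLinear.

Variables (T : finType) (e : rel T).
Hypothesis e_sym : symmetric e.

Lemma chromatic_linear0 : chromatic_linear e set0 = 0.
Proof.
rewrite ffunE (_ : induced_chromatic e set0 = 1) ?derivC ?horner0 //.
apply: poly_int_ext => q; rewrite induced_chromatic_nat hornerC.
elim: q => [|q IHq]; first by rewrite setfun1E eqxx.
rewrite exprS setfunME (big_pred1 set0) => [|W]; last by rewrite subset0.
rewrite setD0 IHq mulr1 ffunE (_ : independent e set0) //.
by apply/forall_inP => u; rewrite inE.
Qed.

(** After multiplication by [A], the inverse of [ind], the left side becomes the restriction of [A]
    to the sets containing [v]. The derivation rule for inverses evaluates it through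
    [chromatic_linear_at], and [ind] cancels [A]. *)
Lemma setfun_sign_unique_source v :
  setfun_sign (setfun_unique_source e v) = - setfun_at v (chromatic_linear e).
Proof.
have inv := setfun_indep_acyclic e_sym; set A := setfun_sign _ in inv.
have sign_at (B : setfun T) : setfun_sign (setfun_at v B) = setfun_at v (setfun_sign B).
  by apply/ffunP => U; rewrite !ffunE mulrCA.
rewrite -[LHS]mulr1 -[RHS]mulr1 -inv [_ * A]mulrC !mulrA; congr (_ * _).
rewrite {1}/A -(rmorphM (@setfun_sign T)) -setfun_at_acyclic //.
rewrite [LHS]sign_at -/A (setfun_at_inv v inv).
by rewrite mulNr (chromatic_linear_at v inv).
Qed.

End ChromaticLinear.

Lemma min_unique_sourceE n (U : {set 'I_n}) (m : 'I_n) (o : {set 'I_n * 'I_n}) :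
  is_min U m -> min_unique_source U o = (sources U o == [set m]).
Proof.
move=> min_m; have /andP[mU /forall_inP le_m] := min_m.
rewrite /min_unique_source (_ : U != set0); last by apply/set0Pn; exists m.
apply/existsP/idP => [[m' /andP[/andP[m'U /forall_inP le_m'] src]]|src]; last first.
  by exists m; rewrite min_m.
suff -> : m = m' by [].
by apply/val_inj/eqP; rewrite eqn_leq le_m // le_m'.
Qed.

(** Restricting to the sets containing [v] changes nothing at [U] when [v] is in [U], so [v] may be
    chosen as the minimum of [U]. *)
Lemma card_min_unique_source n (e : rel 'I_n) (U : {set 'I_n}) : symmetric e ->
  #|[set o in acyclic_orientations e U | min_unique_source U o]|%:R =
  setfun_sign (- chromatic_linear e) U.
Proof.
move=> e_sym; have [->|/set0Pn[x xU]] := eqVneq U set0.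
  rewrite ffunE setfunNE chromatic_linear0 oppr0 mulr0.
  apply/eqP; rewrite pnatr_eq0 cards_eq0; apply/eqP/setP => o.
  by rewrite !inE /min_unique_source eqxx andbF.
case: (arg_minnP val xU) => m mU le_m.
have {}mU : m \in U := mU.
have min_m : is_min U m by rewrite /is_min mU; apply/forall_inP.
transitivity (setfun_unique_source e m U).
  rewrite ffunE; congr (_%:R); apply: eq_card => o.
  by rewrite !inE (min_unique_sourceE _ min_m).
have /(congr1 (@setfun_sign _)) := setfun_sign_unique_source e_sym m.
by rewrite setfun_signK => ->; rewrite !ffunE mU mul1r.
Qed.

Theorem theorem1p1 (n : nat) (e : rel 'I_n)
    (e_sym : symmetric e) (e_irr : irreflexive e) (i j : nat) :
  (-1 : int) ^ (n%:Z - i%:Z) * ((chromatic_poly e)^`(i)).[- j%:Z]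
  = #|[set t : {ffun 'I_(i + j) -> {set 'I_n} * {set 'I_n * 'I_n}}
        | admissible e i j t]|%:Z.
Proof.
pose P k U o := acyclic_orientation (induced_edge e U) o
                && ((k < i)%N ==> min_unique_source U o).
have -> : [set t | admissible e i j t] = decorated_partitions (i + j) P setT.
  apply/setP => t; rewrite !inE; do 2!congr (_ && _).
  apply/andP/forallP => [[/forallP H1 /forallP H2] k|H]; first by rewrite /P H1 H2.
  by split; apply/forallP => k; have /andP[] := H k.
have inv := setfun_indep_acyclic e_sym; set A := setfun_sign _ in inv.
rewrite -[RHS]natz card_decorated_partitions big_split_ord /=.
(* The first [i] factors are signed copies of [- chromatic_linear e]. The other [j] count acyclic
   orientations, which is [setfun_sign A] because the sign map is an involution. *)
have w_lo k : (k < i)%N ->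
    [ffun U => #|[set o | P k U o]|%:R] = setfun_sign (- chromatic_linear e).
  move=> ki; apply/ffunP => U; rewrite -card_min_unique_source // ffunE.
  by congr (_%:R); apply: eq_card => o; rewrite !inE /P ki.
have w_hi k : [ffun U => #|[set o | P (i + k)%N U o]|%:R] = setfun_sign A.
  rewrite /A setfun_signK; apply/ffunP => U; rewrite !ffunE.
  by congr (_%:R); apply: eq_card => o; rewrite !inE /P ltnNge leq_addr andbT.
under eq_bigr => k _ do rewrite w_lo //.
under [X in _ = (_ * X : setfun _) _]eq_bigr => k _ do rewrite w_hi.
(* Pulled out of the product, [setfun_sign] contributes (-1)^n on the full vertex set; the power of
   [- chromatic_linear e] contributes (-1)^i. *)
clearbody A; rewrite !prodr_const !card_ord -!rmorphXn -rmorphM ffunE cardsT card_ord.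
have sgn k (B : setfun 'I_n) U : ((-1) ^+ k * B) U = (-1) ^+ k * B U.
  rewrite -signr_odd -[in RHS]signr_odd.
  by case: odd; rewrite ?expr1 ?mulN1r ?expr0 ?mul1r ?setfunNE.
rewrite [(- chromatic_linear e) ^+ i]exprNn -mulrA sgn.
rewrite -(chromatic_eval_neg j inv) -derivn_induced_chromatic.
rewrite induced_chromaticT natz mulrA; congr (_ * _).
(* The integer exponent [n - i] splits because -1 is a unit equal to its own inverse. *)
by rewrite exprzDr ?unitrN1 // -exprz_inv invrN1.
Qed.
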